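(* Let $M_{sa}$ be the model of a given (arbitrary but fixed) instance of the Simultaneous Ascending Auction. For each agent $i\in N$ and some valuation $\vartheta_i$ over individual trades, $M_{sa}\models IR_i$; that is, individual rationality $IR_i$ holds at every stage $t$ of every path $\delta$ of $M_{sa}$.
   Context: **Bid-trees.** $N=\{1,\dots,n\}$ (agents), $G=\{1,\dots,m\}$ (goods), $I=\{z\in\mathbb{Z}:z_{\min}\le z\le z_{\max}\}$ a finite range of integers containing $0$, $I_+=I\cap\{0,1,2,\dots\}$. It is assumed throughout that $I$ is large enough to represent the total supply of goods and the cumulative available money among the agents, and that all components of the bidding language and related optimization problems are bounded by $I$. A bid-tree is either a leaf $\langle q,j,v\rangle$ with $q,v\in I$, $j\in G$ (buy $q$ units of $j$ for $v$), or $IC_x^y(\bar\beta,v)$ with $\bar\beta$ a nonempty finite list of bid-trees (its children), $x,y\in I_+$, $v\in I$; $OR(\bar\beta,v)=IC_1^s(\bar\beta,v)$ where $s$ is the length of $\bar\beta$. For $p_1,\dots,p_m\in I_+$ put $or_{p_1,\dots,p_m}=OR((\langle1,1,p_1\rangle,\langle1,2,p_2\rangle,\dots,\langle1,m,p_m\rangle),0)$. For a bid-tree $B$ and $\lambda\in I^m$, $v(B,\lambda)$ is the maximum of $\sum_\beta v(\beta)sat(\beta)$ ($\beta$ ranging over the nodes of $B$, $v(\beta)$ the value written at $\beta$) over all $sat$ from the nodes to $\{0,1\}$ such that $x\,sat(\beta)\le\sum_{\beta'\text{ child of }\beta}sat(\beta')\le y\,sat(\beta)$ for each node $\beta=IC_x^y(\cdot)$,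 and, for each $j\in G$, the sum of $q\,sat(\beta)$ over leaves $\beta=\langle q,j,v\rangle$ is at most $\lambda_j$ (undefined if there is no such $sat$). Bid-trees $B,B'$ are equivalent if $v(B,\lambda)=v(B',\lambda)$ for all $\lambda\in I^m$ (or both are undefined). $\mathcal{L}$ denotes a fixed maximal set of pairwise non-equivalent bid-trees. **Paths.** For states $W$, initial state $\bar w$, terminal states $T\subseteq W$, legality relation $L\subseteq W\times N\times\mathcal{A}$ ($L(w,i)=\{a:(w,i,a)\in L\}$) and update function $U:W\times\mathcal{A}^n\to W$, a path $\delta$ is a sequence $\bar w=w_0\xrightarrow{d_1}w_1\xrightarrow{d_2}\cdots$ such that for all $t\ge1$: $w_t\ne w_0$; $d_t(i)\in L(w_{t-1},i)$ for all $i\in N$; $w_t=U(w_{t-1},d_t)$; and $w_{t-1}\in T$ implies $w_t=w_{t-1}$. Write $\delta[t]=w_t$, $\theta_i(\delta,t)=d_{t+1}(i)$ (the action performed by $i$ at stage $t$), and $\delta[0,t]$ for the finite prefix $\bar w\xrightarrow{d_1}\cdots\xrightarrow{d_t}w_t$. **Instance and model $M_{sa}$.** An instance is given by $I$ (with largest element $\mathsf{max}$), $n,m,\mathsf{inc}\in I_+\setminus\{0\}$, $\mathsf{start}\in I_+$, and a (finite nonempty) set of actions $\mathcal{A}\subseteq\mathcal{L}$. $W$ is the set of tuples $w=\langle(b_{i,j}),(t_{i,j}),p,(p_j)\rangle$ ($i\in N,j\in G$) with $b_{i,j},t_{i,j}\in\{0,1\}$ and $p,p_j\in I_+$. $\bar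 w$ has all $b_{i,j}=t_{i,j}=0$ and $p=p_j=\mathsf{start}$. $T$ is the set of $w\in W\setminus\{\bar w\}$ such that for each $j\in G$ either $t_{i,j}=1$ for some $i$ or $b_{i,j}=0$ for all $i$. $L$ is the set of $(w,i,or_{pr_1,\dots,pr_m})$ with $w\in W$, $i\in N$, $0\le pr_j<\mathsf{max}-\mathsf{inc}$ for all $j$ and, for each $j$, either ($pr_j=0$ and $t_{i,j}=0$), or ($pr_j=p$ and $t_{i',j}\ne1$ for all $i'\in N$), or ($pr_j=p_j$ and $t_{i,j}=1$). If $w\in T$, $U(w,d)=w$. If $w\notin T$, $U(w,d)=\langle(b'_{i,j}),(t'_{i,j}),p',(p'_j)\rangle$, where $b'_{i,j}=1$ iff $d(i)=or_{pr_1,\dots,pr_m}$ with $pr_j\ne0$ (else $0$); $t'_{i,j}=1$ iff $b'_{i,j}=1$ and $b'_{r,j}\neq 1$ for all $r\in N\setminus\{i\}$ (else $0$); $p'=p+\mathsf{inc}$; $p'_j=p_j+\mathsf{inc}$ if $t'_{r,j}=0$ for all $r\in N$, and $p'_j=p_j$ otherwise. In state $w$: $trade_i=(t_{i,1},\dots,t_{i,m})$ and $payment_i=\sum_jp_jt_{i,j}$. **Individual rationality.** A valuation of agent $i$ over individual trades assigns to each $\lambda_i\in I^m$ a value $\vartheta_i(\lambda_i)\in I$. The utility of agent $i$ in a state is $\vartheta_i(trade_i)-payment_i$. $IR_i$ holds at stage $t$ of $\delta$ if there is a path $\delta'$ of the model with $\delta'[0,t]=\delta[0,t]$, $\theta_r(\delta',t)=\theta_r(\delta,t)$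 for all $r\in N\setminus\{i\}$, and such that for each $x\in I$: if the utility of $i$ in $\delta'[t]$ equals $x$, then the utility of $i$ in $\delta'[t+1]$ is $\ge x$. *)

(* Defs.v *)
From mathcomp Require Import all_boot all_order all_algebra.
From mathcomp Require Import boolp classical_sets cardinality.
Set Implicit Arguments.
Unset Strict Implicit.
Unset Printing Implicit Defensive.
Import Order.TTheory GRing.Theory Num.Theory.
Local Open Scope classical_set_scope.
Local Open Scope ring_scope.

(* Raw syntax over the goods 'I_m; the bounds by I are imposed by [bt_wf]. *)
Inductive bidtree (m : nat) : Type :=
| Leaf of int & 'I_m & int
| IC of int & int & seq (bidtree m) & int.
Arguments Leaf {m}.
Arguments IC {m}.

Definition OR m (l : seq (bidtree m)) (v : int) : bidtree m :=
  IC 1 (size l)%:Z l v.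

Definition or_tree m (p : 'rV[int]_m) : bidtree m :=
  OR [seq Leaf 1 j (p 0 j) | j <- enum 'I_m] 0.

(* A node is identified by its address, the sequence of child indices leading
   to it from the root. *)
Fixpoint nodes m (B : bidtree m) : seq (seq nat) :=
  match B with
  | Leaf _ _ _ => [:: [::]]
  | IC _ _ l _ =>
      [::] :: flatten [seq [seq ia.1 :: a | a <- ia.2]
                      | ia <- zip (iota 0 (size l)) (map (@nodes m) l)]
  end.

Fixpoint subtree m (B : bidtree m) (a : seq nat) : option (bidtree m) :=
  match a, B with
  | [::], _ => Some B
  | k :: a', IC _ _ l _ => if onth l k is Some C then subtree C a' else None
  | _ :: _, Leaf _ _ _ => None
  end.

Definition node_value m (B : bidtree m) (a : seq nat) : int :=
  match subtree B a with
  | Some (Leaf _ _ v) | Some (IC _ _ _ v) => v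
  | None => 0
  end.

Definition node_demand m (B : bidtree m) (j : 'I_m) (a : seq nat) : int :=
  if subtree B a is Some (Leaf q j' _) then (if j' == j then q else 0) else 0.

(* [sat] is total on addresses; only its restriction to [nodes B] matters. *)
Definition feasible m (B : bidtree m) (lam : 'rV[int]_m)
    (sat : seq nat -> bool) : Prop :=
  (forall a x y l v, a \in nodes B -> subtree B a = Some (IC x y l v) ->
     x * (sat a)%:Z <= \sum_(k < size l) (sat (rcons a k))%:Z
                    <= y * (sat a)%:Z) /\
  (forall j, \sum_(a <- nodes B) node_demand B j a * (sat a)%:Z <= lam 0 j).

Definition sat_value m (B : bidtree m) (sat : seq nat -> bool) : int :=
  \sum_(a <- nodes B) node_value B a * (sat a)%:Z.

(* [bt_value B lam z] says that v(B, lam) is defined and equal to z: it holds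
   for no z exactly when no [sat] is feasible. *)
Definition bt_value m (B : bidtree m) (lam : 'rV[int]_m) (z : int) : Prop :=
  (exists2 sat, feasible B lam sat & sat_value B sat = z) /\
  (forall sat, feasible B lam sat -> sat_value B sat <= z).

Section Range.
Variables zmin zmax : int.

Definition inI (z : int) : bool := zmin <= z <= zmax.
Definition inIp (z : int) : bool := inI z && (0 <= z).
Definition inIm m (lam : 'rV[int]_m) : Prop := forall j, inI (lam 0 j).

Fixpoint bt_wf m (B : bidtree m) : bool :=
  match B with
  | Leaf q _ v => inI q && inI v
  | IC x y l v => [&& inIp x, inIp y, inI v, (0 < size l)%N & all (@bt_wf m) l]
  end.

Definition bt_equiv m (B C : bidtree m) : Prop :=
  forall lam, inIm lam -> forall z, bt_value B lam z <-> bt_value C lam z.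

Definition nonequiv_set m (X : set (bidtree m)) : Prop :=
  (forall B, X B -> bt_wf B) /\
  (forall B C, X B -> X C -> B <> C -> ~ bt_equiv B C).

Definition maximal_nonequiv m (X : set (bidtree m)) : Prop :=
  nonequiv_set X /\ (forall Y, nonequiv_set Y -> X `<=` Y -> Y = X).

End Range.

Record saa := Saa {
  zmin : int;
  zmax : int;
  agents : nat;
  goods : nat;
  inc : int;
  start : int;
  lang : set (bidtree goods);
  actions : set (bidtree goods)
}.

Record state (n m : nat) := State {
  bid : 'M[bool]_(n, m);
  trd : 'M[bool]_(n, m);
  clock : int;
  price : 'rV[int]_m
}.

(* [acts d t] is the joint action d_{t+1}, performed at stage t. *)
Record history (n m : nat) := History {
  states : nat -> state n m;
  acts : nat -> {ffun 'I_n -> bidtree m}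
}.

Section Model.
Variable M : saa.
Local Notation n := (agents M).
Local Notation m := (goods M).
Local Notation state := (state n m).
Local Notation inI := (inI (zmin M) (zmax M)).
Local Notation inIp := (inIp (zmin M) (zmax M)).

Definition W : set state :=
  [set w | inIp (clock w) /\ forall j, inIp (price w 0 j)].

Definition init : state :=
  State (const_mx false) (const_mx false) (start M) (const_mx (start M)).

Definition terminal : set state :=
  [set w | W w /\ w <> init /\
     forall j, (exists i, trd w i j) \/ (forall i, ~~ bid w i j)].

Definition legal (w : state) (i : 'I_n) (a : bidtree m) : Prop :=
  W w /\ exists pr : 'rV[int]_m, a = or_tree pr /\
    forall j, 0 <= pr 0 j < zmax M - inc M /\
      [\/ pr 0 j = 0 /\ ~~ trd w i j,
          pr 0 j = clock w /\ (forall i', ~~ trd w i' j)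
        | pr 0 j = price w 0 j /\ trd w i j].

Definition next_bid (d : {ffun 'I_n -> bidtree m}) : 'M[bool]_(n, m) :=
  \matrix_(i, j) `[< exists pr : 'rV[int]_m,
     [/\ forall k, inIp (pr 0 k), d i = or_tree pr & pr 0 j <> 0] >].

Definition next_trd (d : {ffun 'I_n -> bidtree m}) : 'M[bool]_(n, m) :=
  \matrix_(i, j) (next_bid d i j &&
     [forall r, (r != i) ==> ~~ next_bid d r j]).

(* The new prices may leave I; a path must stay in W (see [is_path]), so it
   never takes a step whose formal result lies outside W. *)
Definition update (w : state) (d : {ffun 'I_n -> bidtree m}) : state :=
  if `[< terminal w >] then w else
  State (next_bid d) (next_trd d) (clock w + inc M)
    (\row_j (if [forall r, ~~ next_trd d r j] then price w 0 j + inc M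
             else price w 0 j)).

Definition is_path (delta : history n m) : Prop :=
  states delta 0%N = init /\
  (forall t, W (states delta t)) /\
  forall t,
    [/\ states delta t.+1 <> states delta 0%N,
        forall i, legal (states delta t) i (acts delta t i),
        states delta t.+1 = update (states delta t) (acts delta t)
      & terminal (states delta t) -> states delta t.+1 = states delta t].

Definition same_prefix (delta delta' : history n m) (t : nat) : Prop :=
  (forall k, (k <= t)%N -> states delta' k = states delta k) /\
  (forall k, (k < t)%N -> acts delta' k = acts delta k).

Definition trade (w : state) (i : 'I_n) : 'rV[int]_m :=
  \row_j (trd w i j)%:Z.

Definition payment (w : state) (i : 'I_n) : int :=
  \sum_j price w 0 j * (trd w i j)%:Z.

(* Only the values on I^m are constrained, and only those are ever used. *)
Definition valuation (theta : 'rV[int]_m -> int) : Prop :=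
  forall lam, inIm (zmin M) (zmax M) lam -> inI (theta lam).

Definition utility (theta : 'rV[int]_m -> int) (w : state) (i : 'I_n) : int :=
  theta (trade w i) - payment w i.

Definition IR (theta : 'rV[int]_m -> int) (i : 'I_n)
    (delta : history n m) (t : nat) : Prop :=
  exists delta', [/\ is_path delta',
    same_prefix delta delta' t,
    forall r, r != i -> acts delta' t r = acts delta t r
  & forall x, inI x -> utility theta (states delta' t) i = x ->
      x <= utility theta (states delta' t.+1) i].

(* The last clause is the typing L <= W x N x A of the legality relation: the
   bid-trees or_{pr} occurring in [legal] are actions of the instance (so they
   are the chosen representatives of their classes in [lang]). *)
Definition is_instance : Prop :=
  [/\ [/\ inI 0, inI n%:Z & inI m%:Z],
      [/\ (0 < n)%N, (0 < m)%N, inIp (inc M), inc M != 0 & inIp (start M)],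
      maximal_nonequiv (zmin M) (zmax M) (@lang M),
      [/\ @actions M `<=` @lang M, finite_set (@actions M)
        & @actions M !=set0]
    & forall w i a, legal w i a -> @actions M a].

End Model.

(* Main.v *)
(** An agent holding a good must repeat her bid, and all the others must then
    stay out of that good, so holdings and their prices never change once
    acquired.  Hence an agent who bids exactly for what she holds, at its current
    price, keeps her trade and payment.  The remaining difficulty is that this
    deviation must extend to an infinite path inside the bounded set of states.
    If the deviating successor is not terminal, then some good is contested by
    agents other than the deviator, so the successor on the original path is not
    terminal either and there is room for one more price increment; when every
    agent then bids only for her holdings, that increment ends the auction. *)
Require Import Defs.
From mathcomp Require Import all_boot all_order all_algebra.
From mathcomp Require Import boolp zify.
Set Implicit Arguments.
Unset Strict Implicit.
Unset Printing Implicit Defensive.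
Import Order.TTheory GRing.Theory Num.Theory.
Local Open Scope ring_scope.

(** * Bids forced by legality *)

Lemma or_tree_inj (m : nat) : injective (@or_tree m).
Proof.
move=> p q [] _ /eq_in_map E; apply/rowP => j.
by have [] := E j (mem_enum _ j).
Qed.

Lemma instance_bounds (M : saa) :
  is_instance M -> [/\ zmin M <= 0, 0 < inc M, 0 <= start M & (0 < goods M)%N].
Proof.
move=> [[/andP[z0 _] _ _] [_ m0 /andP[_ i0] i1 /andP[_ s0]] _ _ _].
by split=> //; rewrite lt_def i1.
Qed.

(** Invariant of the states on a path. The lower bound on the clock keeps later states apart from
    [init]; a positive price under the cap makes repeating a winning bid both legal and a genuine
    bid. *)
Definition sound (M : saa) (w : state (agents M) (goods M)) : Prop :=
  start M <= clock w /\ forall j,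
  [/\ forall i r, trd w i j -> trd w r j -> r = i,
      price w 0 j <= clock w,
      (forall i, ~~ trd w i j) -> price w 0 j = clock w
    & forall i, trd w i j -> 0 < price w 0 j < zmax M - inc M].

(** By injectivity of [or_tree], the price vector that witnesses legality is the only one [next_bid]
    can see; the cap puts its entries in range. *)
Lemma legal_next_bid (M : saa) (hM : is_instance M)
    (w : state (agents M) (goods M)) (d : {ffun 'I_(agents M) -> bidtree (goods M)})
    (i : 'I_(agents M)) :
  legal w i (d i) -> exists pr : 'rV[int]_(goods M),
    (forall j, next_bid d i j = (pr 0 j != 0)) /\
    forall j, 0 <= pr 0 j < zmax M - inc M /\
      [\/ pr 0 j = 0 /\ ~~ trd w i j,
          pr 0 j = clock w /\ (forall i', ~~ trd w i' j)
        | pr 0 j = price w 0 j /\ trd w i j].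
Proof.
have [z0 i0 _ _] := instance_bounds hM.
move=> [_ [pr [E P]]]; exists pr; split=> // j; rewrite mxE.
apply/asboolP/idP => [[pr' [_]]|/eqP nz].
  by rewrite E => /or_tree_inj -> /eqP.
exists pr; split=> // k; have [H _] := P k; rewrite /inIp /inI; lia.
Qed.

Lemma next_bid_unheld (M : saa) (hM : is_instance M)
    (w : state (agents M) (goods M)) (d : {ffun 'I_(agents M) -> bidtree (goods M)})
    (i : 'I_(agents M)) (j : 'I_(goods M)) :
  legal w i (d i) -> (forall r, ~~ trd w r j) -> next_bid d i j ->
  0 < clock w < zmax M - inc M.
Proof.
move=> /(legal_next_bid hM)[pr [E P]] U; rewrite E => nz.
have [H [[H0 _]|[<- _]|[_ H1]]] := P j; [lia|lia|].
by move: (U i); rewrite H1.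
Qed.

(** The holder may not bid zero and the clock price needs an unheld good, so only her own positive
    price remains. A rival does not hold the good, by uniqueness, and is left with zero. *)
Lemma next_bid_held (M : saa) (hM : is_instance M)
    (w : state (agents M) (goods M)) (d : {ffun 'I_(agents M) -> bidtree (goods M)})
    (i r : 'I_(agents M)) (j : 'I_(goods M)) :
  sound w -> legal w r (d r) -> trd w i j -> next_bid d r j = (r == i).
Proof.
move=> [_ /(_ j)[U _ _ C]] /(legal_next_bid hM)[pr [E P]] T; rewrite E.
have := C i T; have [_ [[-> H]|[_ /(_ i)]|[-> H]]] := P j.
- by rewrite eqxx => _; apply/esym/negP => /eqP e; rewrite e T in H.
- by rewrite T.
- by rewrite (U i r T H) eqxx; lia.
Qed.

Lemma next_trd_held (M : saa) (hM : is_instance M)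
    (w : state (agents M) (goods M)) (d : {ffun 'I_(agents M) -> bidtree (goods M)})
    (i r : 'I_(agents M)) (j : 'I_(goods M)) :
  sound w -> (forall k, legal w k (d k)) -> trd w i j ->
  next_trd d r j = (r == i).
Proof.
move=> S L T; rewrite mxE (next_bid_held hM S (L r) T).
case: eqP => //= ->; apply/forallP => k; apply/implyP.
by rewrite (next_bid_held hM S (L k) T).
Qed.

Lemma next_trd_bid (M : saa) (d : {ffun 'I_(agents M) -> bidtree (goods M)})
    (i : 'I_(agents M)) (j : 'I_(goods M)) :
  next_trd d i j -> next_bid d i j.
Proof. by rewrite mxE => /andP[]. Qed.

Lemma next_trd_uniq (M : saa) (d : {ffun 'I_(agents M) -> bidtree (goods M)})
    (i r : 'I_(agents M)) (j : 'I_(goods M)) :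
  next_trd d i j -> next_trd d r j -> r = i.
Proof.
rewrite mxE => /andP[_ /forallP/(_ r)] + /next_trd_bid B.
by rewrite B implybF negbK => /eqP.
Qed.

Lemma update_terminal (M : saa) (w : state (agents M) (goods M))
    (d : {ffun 'I_(agents M) -> bidtree (goods M)}) :
  terminal w -> update w d = w.
Proof. by move=> T; rewrite /update asboolT. Qed.

Lemma update_running (M : saa) (w : state (agents M) (goods M))
    (d : {ffun 'I_(agents M) -> bidtree (goods M)}) :
  ~ terminal w -> update w d =
  State (next_bid d) (next_trd d) (clock w + inc M)
    (\row_j (if [forall r, ~~ next_trd d r j] then price w 0 j + inc M
             else price w 0 j)).
Proof. by move=> T; rewrite /update asboolF. Qed.

(** * Invariance of soundness and of the state space *)

Lemma sound_init (M : saa) : sound (init M).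
Proof.
split=> // j; split=> [i r|||i] /=; rewrite ?mxE //.
Qed.

Lemma sound_update (M : saa) (hM : is_instance M)
    (w : state (agents M) (goods M)) (d : {ffun 'I_(agents M) -> bidtree (goods M)}) :
  sound w -> (forall i, legal w i (d i)) -> sound (update w d).
Proof.
move=> S L; have [z0 i0 _ _] := instance_bounds hM.
have [T|T] := pselect (terminal w); first by rewrite update_terminal.
rewrite update_running //; have [Sc Sj] := S.
split=> [/=|j]; first lia.
have [U Cl Ce Ch] := Sj j.
split=> [i r|||i] /=.
- exact: next_trd_uniq.
- by rewrite mxE; case: ifP; lia.
(* A good unheld after the update was unheld before, since holders keep their goods; so its price
   and the clock rise together. *)
- move=> N; rewrite mxE (introT forallP N) Ce // => r.
  apply/negP => Tr; have := N r.
  by rewrite (next_trd_held hM r S L Tr) eqxx.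
- move=> N; rewrite mxE ifF; last by apply/negP => /forallP/(_ i); rewrite N.
  (* For a newly won good the price is the clock, which the winner has just legally bid; otherwise
     the old bounds persist. *)
  have [/forallP H|/forallPn[r]] := boolP [forall r, ~~ trd w r j].
    by rewrite Ce //; exact: next_bid_unheld (L i) H (next_trd_bid N).
  by rewrite negbK => /Ch.
Qed.

(** Prices never exceed the clock, so room for the clock is enough. *)
Lemma W_update (M : saa) (hM : is_instance M)
    (w : state (agents M) (goods M)) (d : {ffun 'I_(agents M) -> bidtree (goods M)}) :
  sound w -> W w -> (~ terminal w -> clock w + inc M <= zmax M) ->
  W (update w d).
Proof.
move=> [_ S] Ww H; have [z0 i0 _ _] := instance_bounds hM.
have [T|T] := pselect (terminal w); first by rewrite update_terminal.
rewrite update_running //; have := H T; have [Wc Wp] := Ww => Hc.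
split=> [/=|j /=]; first by move: Wc; rewrite /inIp /inI; lia.
rewrite mxE; move: (Wp j); have [_ + _ _] := S j.
by rewrite /inIp /inI; case: ifP => _; lia.
Qed.

Lemma update_neq_init (M : saa) (hM : is_instance M)
    (w : state (agents M) (goods M)) (d : {ffun 'I_(agents M) -> bidtree (goods M)}) :
  sound w -> update w d <> init M.
Proof.
move=> [Sc _]; have [_ i0 _ _] := instance_bounds hM.
have [T|T] := pselect (terminal w).
  by rewrite update_terminal //; case: T => _ [].
by rewrite update_running // => /(congr1 (@clock _ _)) /=; lia.
Qed.

(** * Bidding exactly for current holdings *)

Definition hold (M : saa) (w : state (agents M) (goods M)) :
    {ffun 'I_(agents M) -> bidtree (goods M)} :=
  [ffun i => or_tree (\row_j (if trd w i j then price w 0 j else 0))].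

Lemma legal_hold (M : saa) (w : state (agents M) (goods M)) (i : 'I_(agents M)) :
  0 < zmax M - inc M -> sound w -> W w -> legal w i (hold w i).
Proof.
move=> z [_ S] Ww; split=> //; rewrite ffunE; eexists; split; first by [].
move=> j; rewrite !mxE; have [_ _ _ C] := S j; case: ifP => T.
  by split; [have := C _ T; lia | apply: Or33].
by split; [rewrite z | apply: Or31].
Qed.

Lemma next_bid_hold (M : saa) (w : state (agents M) (goods M))
    (d : {ffun 'I_(agents M) -> bidtree (goods M)})
    (i : 'I_(agents M)) (j : 'I_(goods M)) :
  d i = hold w i -> next_bid d i j -> trd w i j.
Proof.
rewrite mxE ffunE => -> /asboolP[pr [_ /or_tree_inj <-]].
by rewrite mxE; case: ifP.
Qed.

(** Held goods stay held, and unheld goods receive no bid. *)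
Lemma terminal_hold (M : saa) (hM : is_instance M)
    (w : state (agents M) (goods M)) :
  sound w -> (forall i, legal w i (hold w i)) -> W (update w (hold w)) ->
  terminal (update w (hold w)).
Proof.
move=> S L; have [T|T] := pselect (terminal w); first by rewrite update_terminal.
move=> Wu; split=> //; split; first exact: update_neq_init.
rewrite update_running //= => j.
have [/existsP[r Tr]|/existsPn N] := boolP [exists r, trd w r j].
  by left; exists r; rewrite (next_trd_held hM r S L Tr).
by right=> i; apply/negP => /(next_bid_hold erefl) H; move: (N i); rewrite H.
Qed.

(** * Extending a deviation to an infinite path *)

Lemma path_sound (M : saa) (hM : is_instance M)
    (delta : history (agents M) (goods M)) (t : nat) :
  is_path delta -> sound (states delta t).
Proof.
move=> [P0 [_ P]]; elim: t => [|t IH]; first by rewrite P0; exact: sound_init.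
by have [_ L -> _] := P t; exact: sound_update.
Qed.

(** The next state of the path lies in [W], and its clock is one increment further. *)
Lemma path_room (M : saa) (hM : is_instance M)
    (delta : history (agents M) (goods M)) (t : nat) :
  is_path delta -> ~ terminal (states delta t) ->
  clock (states delta t) + inc M <= zmax M.
Proof.
move=> [_ [Wd P]] T; have [_ _ E _] := P t.
by move: (Wd t.+1) => []; rewrite E update_running //= => /andP[/andP[_ ->]].
Qed.

Lemma cap_gt0 (M : saa) (hM : is_instance M) (w : state (agents M) (goods M))
    (i : 'I_(agents M)) (a : bidtree (goods M)) :
  legal w i a -> 0 < zmax M - inc M.
Proof.
have [_ _ _ m0] := instance_bounds hM.
by move=> [_ [pr [_ /(_ (Ordinal m0))[H _]]]]; lia.
Qed.

(** Splicing: follow [delta] up to stage [t], play [d], then let everyone play [hold]; the resulting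
    state is terminal and repeats forever. The two memberships in [W] are where the bounded range
    enters. *)
Lemma path_deviation (M : saa) (hM : is_instance M)
    (delta : history (agents M) (goods M)) (t : nat)
    (d : {ffun 'I_(agents M) -> bidtree (goods M)}) :
  let w' := update (states delta t) d in
  is_path delta -> (forall i, legal (states delta t) i (d i)) ->
  W w' -> W (update w' (hold w')) -> (0 < agents M)%N ->
  exists delta', [/\ is_path delta', same_prefix delta delta' t,
    acts delta' t = d & states delta' t.+1 = w'].
Proof.
move=> w' Pd Ld Ww Wq n0; have Sd := path_sound hM t Pd.
have z : 0 < zmax M - inc M by exact: cap_gt0 (Ld (Ordinal n0)).
have [P0 [Wd P]] := Pd.
have S' : sound w' by exact: sound_update.
have L' i : legal w' i (hold w' i) by exact: legal_hold.
pose q := update w' (hold w').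
have Tq : terminal q by exact: terminal_hold.
have Sq : sound q by exact: sound_update.
pose s k := if (k <= t)%N then states delta k else if k == t.+1 then w' else q.
pose a k := if (k < t)%N then acts delta k else if k == t then d else hold (s k).
have sle k : (k <= t)%N -> s k = states delta k by rewrite /s => ->.
have sS : s t.+1 = w' by rewrite /s ltnn eqxx.
have sgt k : (t.+1 < k)%N -> s k = q.
  by move=> h; rewrite /s leqNgt (ltnW h) gtn_eqF.
have Sk k : sound (s k).
  by rewrite /s; case: ifP => _; [exact: path_sound | case: ifP].
have Wk k : W (s k) by rewrite /s; case: ifP => _ //; case: ifP.
have Lk k i : legal (s k) i (a k i).
  rewrite /a; case: ltngtP => [h|h|->]; last by rewrite sle.
    by rewrite sle 1?ltnW //; have [_] := P k.
  exact: legal_hold.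
have Uk k : s k.+1 = update (s k) (a k).
  rewrite /a; case: ltngtP => [h|h|->]; last by rewrite sS sle.
    by rewrite !sle // 1?ltnW //; have [_ _] := P k.
  (* At [t.+1] this is the definition of [q]; later, [q] is terminal and absorbs every action. *)
  rewrite sgt //; move: h; rewrite leq_eqVlt => /orP[/eqP<-|h].
    by rewrite sS.
  by rewrite sgt // update_terminal.
exists (History s a); split=> //=.
- split=> /=; first by rewrite sle.
  split=> // k; split=> //=.
  + by rewrite Uk (sle 0%N) // P0; exact: update_neq_init.
  + by move=> T; rewrite Uk update_terminal.
- by split=> k h; [exact: sle | rewrite /= /a h].
- by rewrite /a ltnn eqxx.
Qed.

Lemma utility_hold (M : saa) (hM : is_instance M)
    (theta : 'rV[int]_(goods M) -> int) (w : state (agents M) (goods M))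
    (d : {ffun 'I_(agents M) -> bidtree (goods M)}) (i : 'I_(agents M)) :
  sound w -> (forall r, legal w r (d r)) -> d i = hold w i ->
  utility theta (update w d) i = utility theta w i.
Proof.
move=> S L E; have [T|T] := pselect (terminal w); first by rewrite update_terminal.
rewrite update_running // /utility /trade /payment.
have Et j : next_trd d i j = trd w i j.
  apply/idP/idP => [/next_trd_bid/(next_bid_hold E) //|Ti].
  by rewrite (next_trd_held hM i S L Ti).
congr (theta _ - _); first by apply/rowP => j; rewrite mxE [RHS]mxE /= Et.
apply: eq_bigr => j _ /=; rewrite Et mxE.
(* A price rises only on a good nobody holds next, where the payment term is zero. *)
case: ifP => // /forallP/(_ i); rewrite Et => /negbTE ->.
by rewrite !mulr0.
Qed.

(** Only goods unheld in [w] matter; on these the deviator makes no bid and the others bid as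
    before. *)
Lemma terminal_deviation (M : saa) (hM : is_instance M)
    (w : state (agents M) (goods M))
    (d d' : {ffun 'I_(agents M) -> bidtree (goods M)}) (i : 'I_(agents M)) :
  sound w -> (forall r, legal w r (d' r)) -> W (update w d') ->
  d' i = hold w i -> (forall r, r != i -> d' r = d r) ->
  terminal (update w d) -> terminal (update w d').
Proof.
move=> S L W' Ei Er; have [T|T] := pselect (terminal w).
  by rewrite !update_terminal.
move=> [_ [_ Td]]; split=> //; split; first exact: update_neq_init.
move: Td; rewrite !update_running //= => Td j.
have [/existsP[r Tr]|/existsPn N] := boolP [exists r, trd w r j].
  by left; exists r; rewrite (next_trd_held hM r S L Tr).
have Bi : ~~ next_bid d' i j.
  by apply/negP => /(next_bid_hold Ei) H; move: (N i); rewrite H.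
have Br r : r != i -> next_bid d' r j = next_bid d r j.
  by move=> /Er e; rewrite !mxE e.
have [[r]|N'] := Td j; last first.
  by right=> r; have [->//|/Br->] := eqVneq r i.
rewrite mxE => /andP[B /forallP U].
(* A good that [d] gives to the deviator now gets no bid at all; one that it gives to another agent
   keeps the same sole bidder. *)
have [e|ne] := eqVneq r i.
  right=> k; have [->//|nk] := eqVneq k i.
  by rewrite Br //; move: (U k); rewrite e nk.
left; exists r; rewrite mxE Br // B; apply/forallP => k; apply/implyP => kr.
have [->//|nk] := eqVneq k i.
by rewrite Br //; move: (U k); rewrite kr.
Qed.

Theorem theorem3 (M : saa) (hM : is_instance M) (i : 'I_(agents M))
    (theta : 'rV[int]_(goods M) -> int) (htheta : valuation theta)
    (delta : history (agents M) (goods M)) (hdelta : is_path delta)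
    (t : nat) :
  IR theta i delta t.
Proof.
have [_ [Wd P]] := hdelta; have [_ L E _] := P t.
have S := path_sound hM t hdelta.
pose w := states delta t.
pose d : {ffun 'I_(agents M) -> bidtree (goods M)} :=
  [ffun r => if r == i then hold w i else acts delta t r].
have z : 0 < zmax M - inc M by exact: cap_gt0 (L i).
have di : d i = hold w i by rewrite ffunE eqxx.
have dr r : r != i -> d r = acts delta t r by move=> /negbTE h; rewrite ffunE h.
have Ld r : legal w r (d r).
  by have [->|/dr->//] := eqVneq r i; rewrite di; exact: legal_hold z S (Wd t).
have Ww : W (update w d).
  exact (W_update hM d S (Wd t) (path_room hM hdelta)).
have Wq : W (update (update w d) (hold (update w d))).
  apply: W_update => //; first exact: sound_update.
  move=> Td.
  have T1 : ~ terminal (states delta t.+1).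
    by rewrite E => /(terminal_deviation hM S Ld Ww di dr).
  have Tw : ~ terminal w by move=> T; apply: Td; rewrite update_terminal.
  (* Both successors of [w] have the same clock, so the room found on the original path serves the
     deviation. *)
  have := path_room hM hdelta T1.
  by rewrite E !update_running.
have n0 : (0 < agents M)%N by exact: leq_ltn_trans (leq0n i) (ltn_ord i).
have [delta' [P' pre ad sd]] := path_deviation hM hdelta Ld Ww Wq n0.
exists delta'; split=> // [r ri|x _ <-]; first by rewrite ad dr.
have [-> // _] := pre.
by rewrite sd (utility_hold hM theta S Ld di).
Qed.
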